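(* Let $h>0$, $a\in\mathbb{R}$, $\nu\in(0,1]$, $y:(h\mathbb{N})_a\to\mathbb{R}$, and let $m\ge1$ be an integer. Then $$({}_a\Delta_{h}^{\nu}y^{2^m})(t)\le 2^m\,y^{2^m-1}(t+\nu h)\,({}_a\Delta_{h}^{\nu}y)(t),\qquad t\in(h\mathbb{N})_{a+(1-\nu)h}.$$
   Context: For $h>0$ and $a\in\mathbb{R}$, $(h\mathbb{N})_a=\{a,a+h,a+2h,\dots\}$, $\sigma(t)=t+h$, and $(\Delta_h y)(t)=\frac{y(t+h)-y(t)}{h}$. The $h$-factorial function is $t_h^{(\alpha)}=h^{\alpha}\frac{\Gamma(t/h+1)}{\Gamma(t/h+1-\alpha)}$, taken to be $0$ when $t/h+1-\alpha$ is a nonpositive integer and $t/h+1$ is not. For $\mu>0$ the fractional $h$-sum is $({}_a\Delta_h^{-\mu}y)(t)=\frac{h}{\Gamma(\mu)}\sum_{s=a/h}^{t/h-\mu}(t-\sigma(sh))_h^{(\mu-1)}y(sh)$ for $t\in(h\mathbb{N})_{a+\mu h}$, where $s$ runs over $a/h,a/h+1,\dots,t/h-\mu$ and $\sigma(sh)=(s+1)h$; and ${}_a\Delta_h^{0}y=y$. For $\nu\in(0,1]$ the Riemann–Liouville-like fractional $h$-difference is $({}_a\Delta_{h}^{\nu}y)(t)=(\Delta_h({}_a\Delta_h^{-(1-\nu)}y))(t)$, $t\in(h\mathbb{N})_{a+(1-\nu)h}$ (so it equals $\Delta_h y$ if $\nu=1$). Here $y^{2^m}$ is the pointwise power and $y^{2^m-1}(t+\nu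 h)=(y(t+\nu h))^{2^m-1}$. *)

(* Defs.v *)
From HB Require Import structures.
From mathcomp Require Import all_boot all_order all_algebra.
From mathcomp Require Import all_classical all_reals all_analysis.

Set Implicit Arguments.
Unset Strict Implicit.
Unset Printing Implicit Defensive.

Import Order.TTheory GRing.Theory Num.Theory.
Import numFieldNormedType.Exports.

Local Open Scope classical_set_scope.
Local Open Scope ring_scope.

(* Euler's integral, the Gamma function on the positive half-line. *)
Definition euler_Gamma (R : realType) (x : R) : R :=
  \int[lebesgue_measure]_(u in `]0, +oo[) (u `^ (x - 1) * expR (- u)).

(* Extension to x <= 0 by Gamma(x) = Gamma(x + n) / (x (x + 1) ... (x + n - 1)),
   where n is the least natural number with x + n > 0. At the nonpositive
   integers one factor of the product vanishes and the value is the junk 0. *)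
Definition Gamma (R : realType) (x : R) : R :=
  let n := if x <= 0 then (Num.truncn (- x)).+1 else 0%N in
  euler_Gamma (x + n%:R) / \prod_(i < n) (x + i%:R).

Definition Gamma_pole (R : realType) (x : R) : Prop :=
  exists n : nat, x = - n%:R.

Definition hfactorial (R : realType) (h t alpha : R) : R :=
  if `[< Gamma_pole (t / h + 1 - alpha) /\ ~ Gamma_pole (t / h + 1) >] then 0
  else h `^ alpha * (Gamma (t / h + 1) / Gamma (t / h + 1 - alpha)).

Definition hgrid (R : realType) (h a : R) : set R :=
  [set t | exists n : nat, t = a + n%:R * h].

Definition sigma (R : realType) (h t : R) : R := t + h.

(* Functions on a grid are represented by total functions R -> R; only the
   values at grid points matter. *)
Definition hdelta (R : realType) (h : R) (y : R -> R) (t : R) : R :=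
  (y (t + h) - y t) / h.

(* The index s runs over a/h, a/h + 1, ..., t/h - mu as a real number, a/h
   being in general not an integer. *)
Definition hsum (R : realType) (h a mu : R) (y : R -> R) (t : R) : R :=
  if mu == 0 then y t
  else h / Gamma mu *
       \sum_(s \in [set s | hgrid 1 (a / h) s /\ s <= t / h - mu])
          hfactorial h (t - sigma h (s * h)) (mu - 1) * y (s * h).

Definition hdiff (R : realType) (h a nu : R) (y : R -> R) (t : R) : R :=
  hdelta h (hsum h a (1 - nu) y) t.

(* Main.v *)
Require Import Defs.
From HB Require Import structures.
From mathcomp Require Import all_boot all_order all_algebra.
From mathcomp Require Import all_classical all_reals all_analysis.
From mathcomp Require Import measurable_realfun.
From mathcomp Require Import ring lra.
Import Order.TTheory GRing.Theory Num.Theory.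
Import numFieldNormedType.Exports.
Local Open Scope classical_set_scope.
Local Open Scope ring_scope.

(** The inequality is a chain rule for convex functions, with f(x) = x^(2^m).

    Write mu = 1 - nu, let t = a + (mu + n) h and y_k = y(a + k h). For
    mu > 0, expanding the two fractional sums at t + h and t gives, up to the
    nonnegative factor h^mu / (Gamma(mu) h),

      w_0 y_(n+1) + sum_(k <= n) (w_(n+1-k) - w_(n-k)) y_k,
      w_j = Gamma(mu + j) / Gamma(j + 1)

    ([hdiffE]). By Gamma(x + 1) = x Gamma(x), w_(j+1) = w_j (mu + j) / (j + 1);
    as mu <= 1, the weights are nonnegative and nonincreasing ([hweightS_le]).
    So every past value y_k, k <= n, has a nonpositive coefficient, while all
    the coefficients add up to w_(n+1) >= 0.

    Let b = y_(n+1) = y(t + nu h) and d = f'(b). Replacing each past f(y_k) by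
    the smaller tangent value f(b) + d (y_k - b) can only increase the
    difference of f(y); what remains is d times the difference of y, plus
    w_(n+1) (f(b) - d b), and f(b) - d b <= f(0) = 0 by the tangent inequality
    at 0 ([hdiff_comp_le]). For mu = 0 the difference is the plain quotient
    and the tangent inequality suffices. The tangent inequality for x^(2^m) is
    [expr2n_tangent_le].

    The functional equation of Gamma on the positive half-line comes from
    exchanging the order of integration in

      Gamma(x + 1) = int_(u > 0) (int_(0 < v <= u) x v^(x-1) dv) e^(-u) du,

    where the integrand is nonnegative ([euler_integralS], [GammaS]). *)

(** * The functional equation of the Gamma function *)

(** For x < 1 the integrand is unbounded at 0, so the fundamental theorem of
    calculus is applied on the segments [u / (n + 2), u], which exhaust ]0, u],
    and the integral over ]0, u] is the limit of these. *)
Lemma integral_powR_itvoc (R : realType) (x u : R) : 0 < x -> 0 < u ->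
  (\int[lebesgue_measure]_(v in `]0%R, u]) (x * v `^ (x - 1))%:E = (u `^ x)%:E)%E.
Proof.
move=> x_gt0 u_gt0.
pose F (n : nat) : set R := `[u / n.+2%:R, u]%classic.
have den_gt0 n : 0 < u / n.+2%:R by rewrite divr_gt0.
have den_to0 : (u / n.+2%:R) @[n --> \oo] --> (0 : R).
  rewrite -[X in _ --> X](mulr0 u); apply: cvgMr.
  by have := @cvg_harmonic R; rewrite -cvg_shiftS.
have bigcupF : \bigcup_n F n = `]0, u]%classic.
  apply/seteqP; split=> [v [n _]|v]; rewrite /F/= !in_itv/=.
    by move=> /andP[v_ge v_le]; rewrite v_le (lt_le_trans (den_gt0 n)).
  move=> /andP[v_gt v_le].
  have [N _ /(_ N (leqnn N)) small] := (cvgr_lt _ den_to0 _ v_gt).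
  by exists N => //=; rewrite in_itv/= v_le ltW.
have intF n : (\int[lebesgue_measure]_(v in F n) (x * v `^ (x - 1))%:E
    = (u `^ x - (u / n.+2%:R) `^ x)%:E)%E.
  have lt_u : u / n.+2%:R < u.
    by rewrite ltr_pdivrMr// ltr_pMr// ltr1n.
  have pos v : u / n.+2%:R <= v -> 0 < v by apply: lt_le_trans.
  have der v : u / n.+2%:R <= v -> is_derive v 1 (@powR R ^~ x) (x * v `^ (x - 1)).
    by move=> /pos v_gt0; exact: is_derive1_powR.
  have cts a v : u / n.+2%:R <= v -> {for v, continuous (@powR R ^~ a)}.
    move=> /pos v_gt0.
    apply: differentiable_continuous; apply/derivable1_diffP.
    by apply: derivable_powR; rewrite in_itv/= v_gt0.
  rewrite (@continuous_FTC2 _ _ (@powR R ^~ x)) ?EFinB//.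
  - apply: continuous_in_subspaceT => v.
    rewrite inE/= in_itv/= => /andP[v_ge _].
    by apply: cvgMr; exact: cts.
  - split.
    + move=> v; rewrite in_itv/= => /andP[v_gt _].
      by apply: ex_derive; exact: der (ltW v_gt).
    + exact/cvg_at_right_filter/cts.
    + exact/cvg_at_left_filter/cts/ltW.
  - move=> v; rewrite in_itv/= => /andP[v_gt _].
    by apply: powR_derive1; rewrite in_itv/= andbT pos// ltW.
have cvgF : (\int[lebesgue_measure]_(v in F n) (x * v `^ (x - 1))%:E)%E
    @[n --> \oo] --> (u `^ x)%:E.
  under eq_cvg do rewrite intF.
  apply: cvg_EFin; first exact: nearW.
  rewrite -[X in _ --> X]subr0; apply: cvgB; first exact: cvg_cst.
  have /cvg_at_rightP := powR_cvg0 x_gt0.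
  by apply; split.
rewrite -bigcupF; apply: cvg_unique cvgF => //.
apply: ge0_nondecreasing_set_cvg_integral.
- move=> i j ij; apply/subsetPset => v; rewrite /F/= !in_itv/= => /andP[v_ge ->].
  rewrite andbT (le_trans _ v_ge)// ler_pM2l// lef_pV2 ?posrE//.
  by rewrite ler_nat.
- by move=> i; exact: measurable_itv.
- move=> i; apply/measurable_EFinP; apply: measurable_funTS.
  by apply: measurable_funM => //; exact: measurable_powR.
- by move=> i v _; rewrite lee_fin mulr_ge0 ?powR_ge0// ltW.
Qed.

Lemma integral_expRN_itvcy (R : realType) (v : R) :
  (\int[lebesgue_measure]_(u in `[v, +oo[) (expR (- u))%:E = (expR (- v))%:E)%E.
Proof.
have der (w : R) : is_derive w 1 (fun u => - expR (- u)) (expR (- w)).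
  by apply: is_derive_eq; rewrite mulrN1 opprK.
have cexpN : continuous (fun u : R => expR (- u)).
  by move=> w; apply: continuous_comp; [exact: opp_continuous|exact: continuous_expR].
rewrite (@ge0_continuous_FTC2y _ _ (fun u => - expR (- u)) _ 0).
- by rewrite EFinN oppeK add0e.
- by move=> w _; exact: expR_ge0.
- exact: continuous_subspaceT.
- by rewrite -oppr0; apply: cvgN; exact: cvgr_expR.
- by move=> w _; exact: ex_derive.
- by apply: cvgN; exact/cvg_at_right_filter/cexpN.
- by move=> w _; rewrite derive1E derive_val.
Qed.

Local Open Scope ereal_scope.

(** Tonelli for K(v, u) = x v^(x-1) e^(-u) on the region 0 < v <= u:
    integrating in v first gives u^x e^(-u), in u first gives
    x v^(x-1) e^(-v). *)
Lemma euler_integralS (R : realType) (x : R) : (0 < x)%R ->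
  \int[lebesgue_measure]_(u in `]0%R, +oo[) (u `^ x * expR (- u))%:E =
  x%:E * \int[lebesgue_measure]_(u in `]0%R, +oo[) (u `^ (x - 1) * expR (- u))%:E.
Proof.
move=> x_gt0; pose mu := @lebesgue_measure R.
pose K (z : R * R) : \bar R :=
  (if (0 < z.1) && (z.1 <= z.2) then x * z.1 `^ (x - 1) * expR (- z.2) else 0)%:E.
have mexpN : measurable_fun [set: R] (fun u : R => expR (- u)).
  by apply: measurableT_comp => //; exact: measurable_expR.
have mK : measurable_fun [set: R * R] K.
  apply/measurable_EFinP; apply: measurable_fun_ifT => //=.
  - apply: measurable_and.
      by apply: measurable_fun_ltr => //; exact: measurable_fst.
    by apply: measurable_fun_ler; [exact: measurable_fst|exact: measurable_snd].
  - apply: measurable_funM.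
      apply: measurable_funM => //.
      by apply: (measurableT_comp (measurable_powR (x - 1))); exact: measurable_fst.
    by apply: (measurableT_comp mexpN); exact: measurable_snd.
have K_ge0 z : 0 <= K z.
  rewrite lee_fin /K; case: ifP => // _.
  by rewrite !mulr_ge0 ?powR_ge0 ?expR_ge0// ltW.
have := fubini_tonelli (m1 := mu) (m2 := mu) K mK K_ge0.
have inner_u v : \int[mu]_u K (v, u) =
    if (0 < v)%R then x%:E * (v `^ (x - 1) * expR (- v))%:E else 0.
  case: ifPn => [v_gt0|/negPf v_le0]; last first.
    by rewrite integral0_eq// => u _; rewrite /K/= v_le0.
  transitivity (\int[mu]_(u in `[v, +oo[)
      ((x * v `^ (x - 1))%:E * (expR (- u))%:E)).
    rewrite [RHS]integral_mkcond; apply: eq_integral => u _.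
    by rewrite patchE mem_setE in_itv/= andbT /K/= v_gt0/= -EFinM; case: ifP.
  rewrite ge0_integralZl//.
  - by rewrite integral_expRN_itvcy -!EFinM mulrA.
  - by apply/measurable_EFinP/measurable_funTS.
  - by rewrite lee_fin mulr_ge0 ?powR_ge0// ltW.
have inner_v u : \int[mu]_v K (v, u) =
    if (0 < u)%R then (u `^ x * expR (- u))%:E else 0.
  case: ifPn => [u_gt0|u_le0]; last first.
    rewrite integral0_eq// => v _; rewrite /K/=; case: ifP => // /andP[v0 vu].
    by rewrite (lt_le_trans v0 vu) in u_le0.
  transitivity (\int[mu]_(v in `]0%R, u])
      ((expR (- u))%:E * (x * v `^ (x - 1))%:E)).
    rewrite [RHS]integral_mkcond; apply: eq_integral => v _.
    by rewrite patchE mem_setE in_itv/= /K/= -EFinM mulrC; case: ifP.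
  rewrite ge0_integralZl//.
  - by rewrite integral_powR_itvoc// -!EFinM mulrC.
  - apply/measurable_EFinP; apply: measurable_funTS.
    by apply: measurable_funM => //; exact: measurable_powR.
  - by move=> v _; rewrite lee_fin mulr_ge0 ?powR_ge0// ltW.
have restr (f : R -> \bar R) :
    \int[mu]_u (if (0 < u)%R then f u else 0) = \int[mu]_(u in `]0%R, +oo[) f u.
  rewrite [RHS]integral_mkcond; apply: eq_integral => u _.
  by rewrite patchE mem_setE in_itv/= andbT; case: ifP.
under [in LHS]eq_integral => v _ do rewrite inner_u.
under [in RHS]eq_integral => u _ do rewrite inner_v.
rewrite !restr => <-.
rewrite ge0_integralZl//.
- apply/measurable_EFinP; apply: measurable_funTS.
  by apply: measurable_funM => //; exact: measurable_powR.
- by move=> v _; rewrite lee_fin mulr_ge0 ?powR_ge0 ?expR_ge0.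
- by rewrite lee_fin ltW.
Qed.

Local Close Scope ereal_scope.

Lemma euler_GammaS (R : realType) (x : R) : 0 < x ->
  euler_Gamma (x + 1) = x * euler_Gamma x.
Proof.
move=> x_gt0; rewrite /euler_Gamma /Rintegral addrK euler_integralS//.
have : (0 <= \int[lebesgue_measure]_(u in `]0%R, +oo[)
    (u `^ (x - 1) * expR (- u))%:E)%E.
  by apply: integral_ge0 => u _; rewrite lee_fin mulr_ge0 ?powR_ge0 ?expR_ge0.
(* [fine] commutes with the factor x even at +oo, where both
   sides are 0. *)
case: (integral _ _ _) => [r|_|]//=.
by rewrite gt0_muley ?lte_fin//= mulr0.
Qed.

Lemma Gamma_euler (R : realType) (x : R) : 0 < x -> Gamma x = euler_Gamma x.
Proof. by move=> x_gt0; rewrite /Gamma leNgt x_gt0/= big_ord0 addr0 divr1. Qed.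

Lemma GammaS (R : realType) (x : R) : 0 < x -> Gamma (x + 1) = x * Gamma x.
Proof. by move=> x_gt0; rewrite !Gamma_euler ?addr_gt0// euler_GammaS. Qed.

Lemma Gamma_ge0 (R : realType) (x : R) : 0 < x -> 0 <= Gamma x.
Proof.
move=> x_gt0; rewrite Gamma_euler//; apply: Rintegral_ge0 => u _.
by rewrite mulr_ge0 ?powR_ge0 ?expR_ge0.
Qed.

(** * The weights of the fractional sum *)

(** The coefficient that the fractional sum of order [mu] puts on the value
    lying [j] steps before the last one, without the common factor
    h^mu / Gamma(mu). *)
Definition hweight {R : realType} (mu : R) (j : nat) : R :=
  Gamma (mu + j%:R) / Gamma j.+1%:R.

Lemma hweight_ge0 (R : realType) (mu : R) (j : nat) :
  0 < mu -> 0 <= hweight mu j.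
Proof. by move=> mu_gt0; rewrite divr_ge0// Gamma_ge0// ltr_wpDr. Qed.

Lemma hweightS (R : realType) (mu : R) (j : nat) : 0 < mu ->
  hweight mu j.+1 = (mu + j%:R) / j.+1%:R * hweight mu j.
Proof.
move=> mu_gt0; rewrite /hweight.
have -> : mu + j.+1%:R = mu + j%:R + 1 by rewrite -natr1 addrA.
have -> : j.+2%:R = j.+1%:R + 1 :> R by rewrite natr1.
by rewrite !GammaS ?ltr_wpDr// invfM mulrACA.
Qed.

Lemma hweightS_le (R : realType) (mu : R) (j : nat) :
  0 < mu -> mu <= 1 -> hweight mu j.+1 <= hweight mu j.
Proof.
move=> mu_gt0 mu_le1; rewrite hweightS//.
apply: ler_piMl; first exact: hweight_ge0.
by rewrite ler_pdivrMr// mul1r -natr1 addrC lerD2l.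
Qed.

(** * Fractional sums and differences on the grid *)

(** Both arguments of Gamma are positive here, so the convention at the poles
    does not apply. *)
Lemma hfactorial_grid (R : realType) (h a mu : R) (n k : nat) :
  0 < h -> 0 < mu -> (k <= n)%N ->
  hfactorial h (a + (mu + n%:R) * h - sigma h ((a / h + k%:R) * h)) (mu - 1) =
  h `^ (mu - 1) * hweight mu (n - k).
Proof.
move=> h_gt0 mu_gt0 le_kn.
have h_neq0 : h != 0 by rewrite gt_eqF.
rewrite /hfactorial /hweight /sigma.
set u := _ / h + 1.
have uE : u = mu + (n - k)%:R by rewrite /u natrB//; field.
have vE : u - (mu - 1) = (n - k).+1%:R by rewrite uE -natr1; ring.
rewrite vE uE; case: asboolP => // -[[i iE] _]; exfalso.
have : 0 < (n - k).+1%:R :> R by rewrite ltr0n.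
by rewrite iE oppr_gt0 ltrn0.
Qed.

Lemma hsumE (R : realType) (h a mu : R) (n : nat) (y : R -> R) :
  0 < h -> 0 < mu ->
  hsum h a mu y (a + (mu + n%:R) * h) =
  h `^ mu / Gamma mu * \sum_(k < n.+1) hweight mu (n - k) * y (a + k%:R * h).
Proof.
move=> h_gt0 mu_gt0; have h_neq0 : h != 0 by rewrite gt_eqF.
rewrite /hsum gt_eqF//.
have -> : [set s | hgrid 1 (a / h) s /\ s <= (a + (mu + n%:R) * h) / h - mu]
    = (fun k : nat => a / h + k%:R) @` `I_n.+1.
  have bndE : (a + (mu + n%:R) * h) / h - mu = a / h + n%:R by field.
  rewrite bndE; apply/seteqP; split=> [_ [[k ->]]|_ [k kn <-]] /=.
    by rewrite mulr1 lerD2l ler_nat => kn; exists k.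
  by split; [exists k; rewrite mulr1|rewrite lerD2l ler_nat].
rewrite fsbig_image; last first.
  by move=> i j _ _ /addrI/eqP; rewrite eqr_nat => /eqP.
rewrite -(fsbig_ord _ _ (fun k => hfactorial h
  (a + (mu + n%:R) * h - sigma h ((a / h + k%:R) * h)) (mu - 1) *
  y ((a / h + k%:R) * h))).
rewrite -(mulr_powRB1 (ltW h_gt0) mu_gt0) !mulr_sumr; apply: eq_bigr => k _.
have le_kn : (k <= n)%N by rewrite -ltnS.
rewrite hfactorial_grid// mulrDl divfK//; ring.
Qed.

(** The newest value y(a + (n + 1) h) occurs in the sum at t + h only, which is
    why its coefficient is a weight and not a difference of weights. *)
Lemma hdiffE (R : realType) (h a nu : R) (n : nat) (y : R -> R) :
  0 < h -> nu < 1 ->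
  hdiff h a nu y (a + (1 - nu + n%:R) * h) =
  h `^ (1 - nu) / Gamma (1 - nu) / h *
  (hweight (1 - nu) 0 * y (a + n.+1%:R * h) +
   \sum_(k < n.+1) (hweight (1 - nu) (n.+1 - k) - hweight (1 - nu) (n - k)) *
     y (a + k%:R * h)).
Proof.
move=> h_gt0 nu_lt1; have mu_gt0 : 0 < 1 - nu by rewrite subr_gt0.
rewrite /hdiff /hdelta.
have -> : a + (1 - nu + n%:R) * h + h = a + (1 - nu + n.+1%:R) * h.
  by rewrite -natr1; ring.
rewrite !hsumE// big_ord_recr/= subnn.
under [in RHS]eq_bigr do rewrite mulrBl.
rewrite sumrB; ring.
Qed.

(** * The chain-rule inequality *)

(** The case nu = 1 is set apart because the fractional sum of order 0 is the
    identity by convention. The hypothesis on [f 0] controls the weight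
    w_(n+1) that is left over when the coefficients are added up. *)
Lemma hdiff_comp_le (R : realType) (h a nu d : R) (f y : R -> R) (n : nat) :
  0 < h -> 0 < nu -> nu <= 1 -> f 0 <= 0 ->
  (forall x, f (y (a + n.+1%:R * h)) + d * (x - y (a + n.+1%:R * h)) <= f x) ->
  hdiff h a nu (f \o y) (a + (1 - nu + n%:R) * h)
    <= d * hdiff h a nu y (a + (1 - nu + n%:R) * h).
Proof.
move=> h_gt0 nu_gt0 nu_le1 f0_le0; set b := y _ => tangent.
have tangent' x : f b - d * b + d * x <= f x by have := tangent x; lra.
move: nu_le1; rewrite le_eqVlt => /predU1P[nu1|nu_lt1].
  rewrite /hdiff /hdelta /hsum nu1 subrr eqxx/= add0r.
  have -> : a + n%:R * h + h = a + n.+1%:R * h by rewrite -natr1; ring.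
  rewrite -/b mulrA ler_wpM2r ?invr_ge0 ?(ltW h_gt0)//.
  by have := tangent (y (a + n%:R * h)); lra.
have mu_gt0 : 0 < 1 - nu by rewrite subr_gt0.
have mu_le1 : 1 - nu <= 1 by rewrite gerBl ltW.
rewrite !hdiffE// mulrCA ler_wpM2l//.
  apply: divr_ge0; last exact: ltW.
  by rewrite divr_ge0 ?powR_ge0 ?Gamma_ge0.
rewrite /= -/b; set w := hweight (1 - nu).
pose c (k : nat) := w (n.+1 - k)%N - w (n - k)%N.
have sum_c : \sum_(k < n.+1) c k = w n.+1 - w 0%N.
  rewrite (reindex_inj rev_ord_inj)/= -(telescope_sumr _ (leq0n n.+1)) big_mkord.
  apply: eq_bigr => k _; have le_kn : (k <= n)%N by rewrite -ltnS.
  by rewrite /c subSS subSn ?leq_subr// subKn.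
have c_le0 (k : 'I_n.+1) : c k <= 0.
  have le_kn : (k <= n)%N by rewrite -ltnS.
  by rewrite subr_le0 subSn// hweightS_le.
have f_tangent0 : f b - d * b <= 0.
  by have := tangent' 0; rewrite mulr0 addr0 => /le_trans; apply.
apply: (@le_trans _ _ (w 0%N * f b +
    \sum_(k < n.+1) c k * (f b - d * b + d * y (a + k%:R * h)))).
  rewrite lerD2l; apply: ler_sum => k _; apply: ler_wnM2l; first exact: c_le0.
  exact: tangent'.
under [in leLHS]eq_bigr do rewrite mulrDr [_ * (d * _)]mulrCA.
rewrite big_split/= -mulr_suml sum_c -mulr_sumr [leRHS]mulrDr addrA lerD2r.
rewrite mulrCA -subr_le0.
rewrite [leLHS](_ : _ = w n.+1 * (f b - d * b)); last by ring.
by rewrite mulr_ge0_le0// hweight_ge0.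
Qed.

(** Induction on the exponent 2^m: with X = x^N and B = b^N, first
    X^2 >= 2 B X - B^2, then the tangent inequality for X is multiplied by 2 B.
    This needs B >= 0, so the induction starts at m = 1 (N even) and not at
    m = 0. *)
Lemma expr2n_tangent_le (R : realDomainType) (m : nat) (b x : R) :
  (1 <= m)%N ->
  b ^+ (2 ^ m) + (2 ^ m)%:R * b ^+ (2 ^ m - 1) * (x - b) <= x ^+ (2 ^ m).
Proof.
case: m => // m _; elim: m => [|m IHm].
  rewrite expn1 subn1 /= -subr_ge0 [leRHS](_ : _ = (x - b) ^+ 2) ?sqr_ge0//.
  rewrite !expr2 expr1; ring.
move: IHm; set N := (2 ^ m.+1)%N => IHm.
have N_gt0 : (0 < N)%N by rewrite expn_gt0.
have bN_ge0 : 0 <= b ^+ N.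
  by rewrite /N expnS exprM exprn_ge0// sqr_ge0.
have -> : (2 ^ m.+2 = N + N)%N by rewrite expnS mul2n addnn.
have -> : (N + N - 1 = N + (N - 1))%N by rewrite addnBA.
apply: (@le_trans _ _ (b ^+ N * x ^+ N *+ 2 - b ^+ N * b ^+ N)).
  have := ler_wpM2l bN_ge0 IHm.
  rewrite !exprD natrD.
  move: (b ^+ N) (b ^+ (N - 1)) (x ^+ N) N%:R => B B' X n'; lra.
rewrite -subr_ge0 exprD [leRHS](_ : _ = (x ^+ N - b ^+ N) ^+ 2) ?sqr_ge0//.
by ring.
Qed.

Theorem proposition4p5 (R : realType) (h a nu : R) (y : R -> R) (m : nat)
    (h_gt0 : 0 < h) (nu_gt0 : 0 < nu) (nu_le1 : nu <= 1) (m_ge1 : (1 <= m)%N)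
    (t : R) (t_grid : hgrid h (a + (1 - nu) * h) t) :
  hdiff h a nu (fun s => y s ^+ (2 ^ m)) t
    <= (2 ^ m)%:R * y (t + nu * h) ^+ (2 ^ m - 1) * hdiff h a nu y t.
Proof.
case: t_grid => n ->.
have -> : a + (1 - nu) * h + n%:R * h = a + (1 - nu + n%:R) * h by ring.
have -> : a + (1 - nu + n%:R) * h + nu * h = a + n.+1%:R * h.
  by rewrite -natr1; ring.
apply: (@hdiff_comp_le R h a nu _ (fun x => x ^+ (2 ^ m))) => //.
- by rewrite expr0n expn_eq0.
- by move=> x; exact: expr2n_tangent_le.
Qed.
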